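(* Assume a Turing instability occurs at $\mu=0$, and consider the stripes on the quasi-square domain $[0,2\pi/\kappa]\times[0,2\pi/\ell]$ ($\kappa=k_c+\tilde\kappa$, $\ell=k_c+\tilde\ell$, rescaled to $[0,2\pi]^2$) with periodic boundary conditions, scaling $(A,\alpha,\beta,\tilde\kappa,\tilde\ell)=(\varepsilon A',\varepsilon^2\alpha',\varepsilon\beta',\varepsilon\kappa',\varepsilon\ell')$, and velocity parameter $c=c(\mu)=-\lambda_\beta+\mathcal{O}(\varepsilon)$ of the stripes. The double eigenvalue of the matrix $L_2^{\rm sq}$ (the subblock of the linearisation in stripes defined in the context) is real and given by $$\lambda=\varepsilon^2\left(A'^2(3k_0-q_2+8q_{11})-\rho_\beta\beta'^2+\rho_\kappa(\ell'^2-\kappa'^2)\right)+\mathcal{O}(\varepsilon^3),$$ where $A'=\sqrt{-(\alpha'+\rho_\beta\beta'^2+\rho_\kappa\kappa'^2)/\rho_{\rm nl}}+\mathcal{O}(\varepsilon)$.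
   Context: System: $u_t=D\Delta u+Lu+\check\alpha Mu+\beta Bu_x+Q[u,u]+K[u,u,u]$, $u\in\mathbb{R}^2$, $\mathbf{x}=(x,y)\in\mathbb{R}^2$; $D=\mathrm{diag}(d_1,d_2)$, $d_i>0$; $L=\begin{pmatrix}a_1&a_2\\ a_3&a_4\end{pmatrix}$ and $M$ real $2\times2$ matrices; $Q$, $K$ symmetric bilinear/trilinear on $\mathbb{R}^2$, extended multilinearly to $\mathbb{C}^2$; $B=B(c)=\mathrm{diag}(1+c,c)$ with $c\in\mathbb{R}$. Turing instability with wavenumber $k_c>0$ at $\check\alpha=\beta=0$: with $\hat{\mathcal L}(k,\ell)=-(k^2+\ell^2)D+L+\check\alpha M+\mathrm{i}k\beta B$ and $d(\lambda,k,\ell)=\det(\hat{\mathcal L}(k,\ell)-\lambda\,\mathrm{Id})$, at $\check\alpha=\beta=0$: (1) all eigenvalues of $L$ have negative real part; (2) $d=0$ and $\mathrm{Re}\,\lambda\ge0$ iff $\lambda=0$ and $k^2+\ell^2=k_c^2$; (3) $\partial_\lambda d\ne0$ there. Set $\lambda_M:=-\partial_{\check\alpha}d/\partial_\lambda d$ (at $\check\alpha=0,\lambda=0$), assumed nonzero, and $\alpha:=\lambda_M\check\alpha$. Coefficients: $E_0,E_0^*\in\mathbb{R}^2$ span the kernels of $-k_c^2D+L$ and its transpose, $\langle E_0,E_0\rangle=\langle E_0,E_0^*\rangle=1$. $(-k_c^2D+L)^{-1}$ denotes the inverse from the range to the kernel of the projection $\langle\cdot,E_0^*\rangle E_0$.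 All coefficients are evaluated at $\mu=0$, where $c=-\lambda_\beta$, $\lambda_\beta=\frac{a_4-k_c^2d_2}{a_1+a_4-k_c^2(d_1+d_2)}$, so $\langle BE_0,E_0^*\rangle=0$. Define $Q_0=-2L^{-1}Q[\overline{E_0},E_0]$, $Q_2=-2(-4k_c^2D+L)^{-1}Q[E_0,E_0]$, $q_0=\langle Q[E_0,Q_0],E_0^*\rangle$, $q_2=\langle Q[\overline{E_0},Q_2],E_0^*\rangle$, $k_0=\langle K[E_0,E_0,\overline{E_0}],E_0^*\rangle$, $\rho_{\rm nl}=3k_0+2q_0+q_2$, $w_{A\beta}=k_c(-k_c^2D+L)^{-1}(\langle BE_0,E_0^*\rangle-B)E_0$, $w_{A\kappa}=2k_c(-k_c^2D+L)^{-1}DE_0$, $\rho_\beta=-k_c\langle Bw_{A\beta},E_0^*\rangle>0$, $\rho_\kappa=-2k_c\langle Dw_{A\kappa},E_0^*\rangle<0$. Standing assumption: $\rho_{\rm nl}<0$. Scaling: as in the claim, with $0<\varepsilon\ll1$ and primed quantities bounded; $\mu=(\alpha,\beta,\tilde\kappa)$. Stripes (known existence result): nontrivial small travelling waves constant in $y$, $2\pi/\kappa$-periodic in $x$, velocity $\beta c$ with $c=c(\mu)=-\lambda_\beta+\mathcal{O}(\varepsilon)$, leading-order profile $2\varepsilon A'E_0\cos(\kappa x)$ up to translation, in 1-to-1 correspondence with solutions $A=\varepsilon A'>0$ of $\varepsilon^2(\alpha'+\rho_\beta\beta'^2+\rho_\kappa\kappa'^2+\rho_{\rm nl}A'^2+\mathcal{O}(\varepsilon))=0$.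 The matrix $L_2^{\rm sq}$: on the rescaled domain $[0,2\pi]^2$ there is a four-dimensional centre manifold with coordinates $u_c=\sum_{j=\pm1,\pm2}u_j\mathrm{e}^{\mathrm{i}\mathbf{k}_j\cdot\mathbf{x}}E_0$, $\mathbf{k}_1=(1,0)$, $\mathbf{k}_2=(0,1)$, $\mathbf{k}_{-j}=-\mathbf{k}_j$. The linearisation of the reduced ODE in stripes in index ordering $(1,-1,2,-2)$ is $\mathrm{diag}(L_1,L_2^{\rm sq})+\mathcal{O}(\varepsilon^3)$ with $L_2^{\rm sq}=\varepsilon^2(\lambda'_{\tilde\ell}+A'^2\xi)\,\mathrm{Id}_2$, where $\lambda'_{\tilde\ell}=\alpha'+\rho_\kappa\ell'^2+\mathcal{O}(\varepsilon)\in\mathbb{R}$, $\xi=6k_0+2q_0+8q_{11}$, $q_{11}=\langle Q[E_0,Q_{11}],E_0^*\rangle$, $Q_{11}=-(-2k_c^2D+L)^{-1}Q[E_0,E_0]$.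
   Formalization: The formula A' = sqrt(...) + O(ε) is stated where the radicand is at least δ, for every δ > 0, with constants depending on δ; where the radicand vanishes, A' can be of order sqrt(ε). *)

(* Defs.v *)
From HB Require Import structures.
From mathcomp Require Import all_boot all_order all_algebra.
From mathcomp Require Import all_classical all_reals all_analysis.
From mathcomp Require Import complex.

Set Implicit Arguments.
Unset Strict Implicit.
Unset Printing Implicit Defensive.

Import Order.TTheory GRing.Theory Num.Theory.
Import numFieldNormedType.Exports.

Local Open Scope classical_set_scope.
Local Open Scope ring_scope.
Local Open Scope complex_scope.

Section LinearAlgebra.
Variable R : realType.

Definition dot (u v : 'cV[R]_2) : R := \sum_i u i 0 * v i 0.

Definition diag2 (a b : R) : 'M[R]_2 :=
  diag_mx (\row_(i < 2) if i == 0 then a else b).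

Definition cmx (A : 'M[R]_2) : 'M[R[i]]_2 := map_mx (real_complex R) A.

Definition double_eigenvalue (A : 'M[R[i]]_2) (z : R[i]) : Prop :=
  eigenvalue A z /\ mup z (char_poly A) = 2%N.

End LinearAlgebra.

(* u_t = D Lap u + L u + calpha M u + beta B(c) u_x + Q[u,u] + K[u,u,u] *)
Record rd_system (R : realType) := RDSystem {
  d1 : R;
  d2 : R;
  Lmx : 'M[R]_2;
  Mmx : 'M[R]_2;
  Q : 'cV[R]_2 -> 'cV[R]_2 -> 'cV[R]_2;
  K : 'cV[R]_2 -> 'cV[R]_2 -> 'cV[R]_2 -> 'cV[R]_2;
  d1_gt0 : 0 < d1;
  d2_gt0 : 0 < d2;
  Q_linear : forall u, linear (Q u);
  Q_sym : forall u v, Q u v = Q v u;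
  K_linear : forall u v, linear (K u v);
  K_sym12 : forall u v w, K u v w = K v u w;
  K_sym23 : forall u v w, K u v w = K u w v
}.

Section System.
Variables (R : realType) (S : rd_system R).

Definition Dmx : 'M[R]_2 := diag2 (d1 S) (d2 S).

Definition Bmx (c : R) : 'M[R]_2 := diag2 (1 + c) c.

Definition Lhat (calpha beta c k l : R) : 'M[R[i]]_2 :=
  cmx (- (k ^+ 2 + l ^+ 2) *: Dmx + Lmx S + calpha *: Mmx S)
  + (Complex 0 (k * beta)) *: cmx (Bmx c).

Definition disp (calpha beta c : R) (lam : R[i]) (k l : R) : R[i] :=
  \det (Lhat calpha beta c k l - lam%:M).

(* complex derivative of disp in lam, at calpha = beta = 0 *)
Definition disp_lam (c : R) (lam : R[i]) (k l : R) : R[i] :=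
  derive1 (fun z : R[i] => disp 0 0 c z k l : R[i]^o) lam.

(* At beta = 0 the factor multiplying B(c) vanishes, so the value of c is
   immaterial below. *)
Definition turing_instability (kc : R) : Prop :=
  [/\ 0 < kc,
      forall z : R[i], eigenvalue (cmx (Lmx S)) z -> complex.Re z < 0,
      forall (c : R) (lam : R[i]) (k l : R),
        (disp 0 0 c lam k l = 0 /\ 0 <= complex.Re lam)
        <-> (lam = 0 /\ k ^+ 2 + l ^+ 2 = kc ^+ 2)
    & forall c k l : R, k ^+ 2 + l ^+ 2 = kc ^+ 2 -> disp_lam c 0 k l != 0].

(* disp is real for beta = 0 and lam = 0, and depends on (k, l) only through
   k^2 + l^2; the critical wave vector (kc, 0) is used. *)
Definition lambda_M (kc : R) : R :=
  - derive1 (fun a : R => complex.Re (disp a 0 0 0 kc 0)) 0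
  / complex.Re (disp_lam 0 0 kc 0).

Definition Lk (s : R) : 'M[R]_2 := - s *: Dmx + Lmx S.

Definition kernel_vectors (kc : R) (E0 E0s : 'cV[R]_2) : Prop :=
  [/\ forall v, Lk (kc ^+ 2) *m v = 0 <-> exists a : R, v = a *: E0,
      forall v, (Lk (kc ^+ 2))^T *m v = 0 <-> exists a : R, v = a *: E0s,
      dot E0 E0 = 1
    & dot E0 E0s = 1].

Section Coefficients.
Variables (kc : R) (E0 E0s : 'cV[R]_2).

(* inverse of -kc^2 D + L from its range onto the kernel of <., E0s> E0 *)
Definition Linv (v : 'cV[R]_2) : 'cV[R]_2 :=
  xget 0 [set w : 'cV[R]_2 | Lk (kc ^+ 2) *m w = v /\ dot w E0s *: E0 = 0].

Definition lambda_beta : R :=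
  (Lmx S 1 1 - kc ^+ 2 * d2 S)
  / (Lmx S 0 0 + Lmx S 1 1 - kc ^+ 2 * (d1 S + d2 S)).

(* B at mu = 0 *)
Definition B0 : 'M[R]_2 := Bmx (- lambda_beta).

(* E0 is real, so that conj E0 = E0 and Q, K are only needed on real vectors. *)
Definition Q0 : 'cV[R]_2 := (-2) *: (invmx (Lmx S) *m Q S E0 E0).
Definition Q2 : 'cV[R]_2 := (-2) *: (invmx (Lk (4 * kc ^+ 2)) *m Q S E0 E0).
Definition Q11 : 'cV[R]_2 := - (invmx (Lk (2 * kc ^+ 2)) *m Q S E0 E0).

Definition q0 : R := dot (Q S E0 Q0) E0s.
Definition q2 : R := dot (Q S E0 Q2) E0s.
Definition q11 : R := dot (Q S E0 Q11) E0s.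
Definition k0 : R := dot (K S E0 E0 E0) E0s.

Definition rho_nl : R := 3 * k0 + 2 * q0 + q2.

Definition wAbeta : 'cV[R]_2 :=
  kc *: Linv (dot (B0 *m E0) E0s *: E0 - B0 *m E0).
Definition wAkappa : 'cV[R]_2 := (2 * kc) *: Linv (Dmx *m E0).

Definition rho_beta : R := - kc * dot (B0 *m wAbeta) E0s.
Definition rho_kappa : R := - (2 * kc) * dot (Dmx *m wAkappa) E0s.

Definition xi : R := 6 * k0 + 2 * q0 + 8 * q11.

End Coefficients.

Section Stripes.

Definition field := R -> R -> 'cV[R]_2.

Definition dx (u : field) : field := fun x y => derive1 (fun s => u s y) x.
Definition dy (u : field) : field := fun x y => derive1 (fun s => u x s) y.

Definition rhs (calpha beta c : R) (u : field) : field := fun x y =>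
  Dmx *m (dx (dx u) x y + dy (dy u) x y) + Lmx S *m u x y
  + calpha *: (Mmx S *m u x y) + beta *: (Bmx c *m dx u x y)
  + Q S (u x y) (u x y) + K S (u x y) (u x y) (u x y).

(* The advection matrix B(c) = diag(1 + c, c) is already written in the frame
   moving with velocity beta c, where the travelling waves are stationary. *)
Definition is_stripe (calpha beta c kappa : R) (u : field) : Prop :=
  [/\ forall x y y', u x y = u x y',
      forall x y, u (x + 2 * pi / kappa) y = u x y,
      exists x y, u x y != 0,
      forall x y, derivable (fun s => u s y) x 1
                  /\ derivable (fun s => dx u s y) x 1
    & forall x y, rhs calpha beta c u x y = 0].

End Stripes.

Section Scaling.
Variables (kc : R) (E0 E0s : 'cV[R]_2).

(* stripes at mu = (eps^2 a, eps b, eps kap), where calpha = alpha/lambda_M,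
   with velocity parameter c(mu) *)
Definition scaled_stripe (c : R -> R -> R -> R) (eps a b kap : R) (u : field) :=
  is_stripe (eps ^+ 2 * a / lambda_M kc) (eps * b)
    (c (eps ^+ 2 * a) (eps * b) (eps * kap)) (kc + eps * kap) u.

Definition small (b eps : R) (u : field) : Prop :=
  forall x y, `|u x y| <= b * eps.

(* c(mu) = - lambda_beta + O(eps) *)
Definition velocity_expansion (c : R -> R -> R -> R) : Prop :=
  forall b0, 0 < b0 -> exists C eps0, 0 < eps0 /\
    forall eps a b kap, 0 < eps < eps0 ->
    `|a| <= b0 -> `|b| <= b0 -> `|kap| <= b0 ->
    `|c (eps ^+ 2 * a) (eps * b) (eps * kap) + lambda_beta kc| <= C * eps.

(* left-hand side of the amplitude equation; rem is its O(eps) term *)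
Definition amplitude_eq (rem : R -> R -> R -> R -> R -> R)
    (eps a b kap A : R) : Prop :=
  eps ^+ 2 * (a + rho_beta kc E0 E0s * b ^+ 2 + rho_kappa kc E0 E0s * kap ^+ 2
              + rho_nl kc E0 E0s * A ^+ 2 + rem eps a b kap A) = 0.

Definition amplitude_remainder (rem : R -> R -> R -> R -> R -> R) : Prop :=
  forall b0, 0 < b0 -> exists C eps0, 0 < eps0 /\
    forall eps a b kap A, 0 < eps < eps0 ->
    `|a| <= b0 -> `|b| <= b0 -> `|kap| <= b0 -> `|A| <= b0 ->
    `|rem eps a b kap A| <= C * eps.

(* Existence of stripes: [amp alpha beta tkappa u] is the amplitude A of the
   small stripe u; up to translation in x, stripes of size O(eps) correspond
   1-to-1 to the bounded solutions A' > 0 of the amplitude equation, with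
   A = eps A'. *)
Definition stripe_existence (c : R -> R -> R -> R)
    (amp : R -> R -> R -> field -> R)
    (rem : R -> R -> R -> R -> R -> R) : Prop :=
  amplitude_remainder rem /\
  forall b0, 0 < b0 -> exists C eps0, 0 < eps0 /\
    forall eps a b kap, 0 < eps < eps0 ->
    `|a| <= b0 -> `|b| <= b0 -> `|kap| <= b0 ->
    let stripe := scaled_stripe c eps a b kap in
    let ampl := amp (eps ^+ 2 * a) (eps * b) (eps * kap) in
    [/\ forall u, stripe u -> small b0 eps u ->
          exists A, [/\ ampl u = eps * A, 0 < A,
            amplitude_eq rem eps a b kap A &
            exists x0, forall x y,
              `|u x y - (2 * eps * A * cos ((kc + eps * kap) * (x + x0))) *: E0|
              <= C * eps ^+ 2],
        forall u v, stripe u -> small b0 eps u -> stripe v -> small b0 eps v ->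
          (ampl u = ampl v <-> exists x0, forall x y, v x y = u (x + x0) y)
      & forall A, 0 < A <= b0 -> amplitude_eq rem eps a b kap A ->
          exists u, [/\ stripe u, small C eps u & ampl u = eps * A]].

(* lambda'_l = a + rho_kappa l^2 + O(eps), where l stands for the scaled
   detuning ell' of the wavenumber ell = kc + eps l in y *)
Definition lambda_ell_expansion (lamell : R -> R -> R -> R -> R -> R) : Prop :=
  forall b0, 0 < b0 -> exists C eps0, 0 < eps0 /\
    forall eps a b kap l, 0 < eps < eps0 ->
    `|a| <= b0 -> `|b| <= b0 -> `|kap| <= b0 -> `|l| <= b0 ->
    `|lamell eps a b kap l - (a + rho_kappa kc E0 E0s * l ^+ 2)| <= C * eps.

(* Subblock, for the coordinates u_2, u_-2 of the modes exp(+-i y) E0 on the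
   domain rescaled to [0, 2 pi]^2, of the linearisation of the reduced equation
   on the centre manifold in the stripe of amplitude eps A. It acts on complex
   coordinates. *)
Definition L2sq (lamell : R -> R -> R -> R -> R -> R)
    (eps a b kap l A : R) : 'M[R[i]]_2 :=
  ((eps ^+ 2 * (lamell eps a b kap l + A ^+ 2 * xi kc E0 E0s))%:C)%:M.

End Scaling.

End System.

(* Main.v *)
(* The amplitude equation, the stripe's O(eps) size and its leading profile
   bound A, so the amplitude remainder is O(eps). Eliminating alpha' between the
   amplitude equation and lambda'_l + A'^2 xi leaves the announced eigenvalue,
   because xi - rho_nl = 3 k_0 - q_2 + 8 q_11. *)
Require Import Defs.
From HB Require Import structures.
From mathcomp Require Import all_boot all_order all_algebra.
From mathcomp Require Import all_classical all_reals all_analysis.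
From mathcomp Require Import complex.
From mathcomp Require Import ring lra.

Import Order.TTheory GRing.Theory Num.Theory.
Import numFieldNormedType.Exports.
Local Open Scope ring_scope.
Local Open Scope complex_scope.

(** The characteristic polynomial is [('X - a%:P) ^+ 2], whose only root [a] has multiplicity
    exactly two. This applies to [L2sq], a real scalar matrix. *)
Lemma double_eigenvalue_scalar (R : realType) (a z : R[i]) :
  double_eigenvalue (a%:M : 'M[R[i]]_2) z <-> z = a.
Proof.
have chi : char_poly (a%:M : 'M[R[i]]_2) = ('X - a%:P) ^+ 2.
  rewrite char_poly_trig ?scalar_mx_is_trig // (eq_bigr (fun=> 'X - a%:P)).
    by rewrite prodr_const card_ord.
  by move=> i _; rewrite mxE eqxx.
rewrite /double_eigenvalue eigenvalue_root_char chi.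
split=> [[+ _]|->]; first by rewrite root_exp_XsubC => /eqP.
by rewrite root_exp_XsubC eqxx mup_XsubCX eqxx.
Qed.

(** Here the norm is the maximum of the entries, not the one induced by [dot], so [dot E0 E0 = 1]
    yields only positivity. This is enough to divide by the norm when bounding the amplitude. *)
Lemma kernel_vectors_norm_gt0 (R : realType) (S : rd_system R) (kc : R)
    (E0 E0s : 'cV[R]_2) :
  kernel_vectors S kc E0 E0s -> 0 < `|E0|.
Proof.
case=> _ _ E01 _; rewrite normr_gt0; apply/eqP => E00; move: E01.
rewrite E00 /dot big1 => [/esym/eqP|i _]; first by rewrite oner_eq0.
by rewrite mxE mul0r.
Qed.

(** The bound on [rem] is uniform only over bounded amplitudes, while smallness is given for [u];
    the profile converts one into the other. Both halves of the theorem rest on this estimate. *)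
Lemma stripe_amplitude_balance (R : realType) (S : rd_system R) (kc : R)
    (E0 E0s : 'cV[R]_2) (c : R -> R -> R -> R)
    (amp : R -> R -> R -> field R -> R) (rem : R -> R -> R -> R -> R -> R) :
  kernel_vectors S kc E0 E0s ->
  stripe_existence S kc E0 E0s c amp rem ->
  forall b0 : R, 0 < b0 ->
  exists C eps0 : R, [/\ 0 <= C, 0 < eps0 &
    forall (eps a b kap A : R) (u : field R), 0 < eps < eps0 ->
    `|a| <= b0 -> `|b| <= b0 -> `|kap| <= b0 ->
    scaled_stripe S kc c eps a b kap u -> small b0 eps u ->
    amp (eps ^+ 2 * a) (eps * b) (eps * kap) u = eps * A ->
    0 < A /\
    `|a + rho_beta S kc E0 E0s * b ^+ 2 + rho_kappa S kc E0 E0s * kap ^+ 2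
      + rho_nl S kc E0 E0s * A ^+ 2| <= C * eps].
Proof.
move=> /kernel_vectors_norm_gt0 E0_gt0 [remP exP] b0 b0_gt0.
have [C1 [e1 [e1_gt0 H1]]] := exP _ b0_gt0.
(* The quotient will bound [A]; the extra [b0] makes [b1] also bound the parameters, so one constant
   serves for all arguments of [rem]. *)
pose b1 := b0 + (b0 + `|C1|) / `|E0|.
have b01 : b0 <= b1 by rewrite lerDl divr_ge0 // addr_ge0 // ltW.
have [C2 [e2 [e2_gt0 H2]]] := remP b1 (lt_le_trans b0_gt0 b01).
(* The threshold 1 gives [eps ^+ 2 <= eps], which absorbs the quadratic profile error. *)
exists `|C2|, (Num.min 1 (Num.min e1 e2)); split=> //.
  by rewrite !lt_min ltr01 e1_gt0.
move=> eps a b kap A u; rewrite !lt_min => /and4P[eps_gt0 eps1 epse1 epse2].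
move=> ha hb hk su smu ampu.
have [|H _ _] := H1 eps a b kap _ ha hb hk; first by rewrite eps_gt0.
have [A' [+ A_gt0 eqA [x0 prof]]] := H u su smu.
rewrite ampu => /(mulfI (lt0r_neq0 eps_gt0)) eA; rewrite -{}eA in A_gt0 eqA prof.
split=> //.
(* evaluating the profile at its crest, where the cosine is 1 *)
have Ab1 : `|A| <= b1.
  have := prof (- x0) 0; rewrite addNr mulr0 cos0 mulr1 => crest.
  have scaled : 2 * eps * A * `|E0| <= b0 * eps + C1 * eps ^+ 2.
    rewrite -{1}(gtr0_norm (mulr_gt0 (mulr_gt0 (ltr0Sn _ 1) eps_gt0) A_gt0)) -normrZ.
    have := ler_normB (u (- x0) 0) (u (- x0) 0 - (2 * eps * A) *: E0).
    rewrite subKr => /le_trans; apply; exact: lerD (smu _ _) crest.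
  have quad : C1 * eps ^+ 2 <= `|C1| * eps.
    apply: le_trans (ler_norm _) _; rewrite normrM (ger0_norm (sqr_ge0 eps)).
    by rewrite ler_wpM2l // expr2 ler_piMr // ltW.
  have AE : A * `|E0| <= b0 + `|C1|.
    have AE_gt0 : 0 < A * `|E0| by rewrite mulr_gt0.
    rewrite -(ler_pM2r eps_gt0) mulrDl; nra.
  by rewrite gtr0_norm // ler_wpDl ?ler_pdivlMr // ltW.
have := H2 eps a b kap A _ (le_trans ha b01) (le_trans hb b01) (le_trans hk b01) Ab1.
rewrite eps_gt0 => /(_ epse2) Hrem.
have -> : a + rho_beta S kc E0 E0s * b ^+ 2 + rho_kappa S kc E0 E0s * kap ^+ 2
  + rho_nl S kc E0 E0s * A ^+ 2 = - rem eps a b kap A.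
  apply/eqP; rewrite -addr_eq0; move/eqP: eqA.
  by rewrite mulf_eq0 expf_eq0 /= (gt_eqF eps_gt0).
rewrite normrN; apply: le_trans Hrem _.
by rewrite ler_pM2r // ler_norm.
Qed.

Arguments stripe_amplitude_balance {R S kc E0 E0s c amp rem}.

Theorem lemma3p8 (R : realType) (S : rd_system R) (kc : R)
    (E0 E0s : 'cV[R]_2)
    (c : R -> R -> R -> R)
    (amp : R -> R -> R -> field R -> R)
    (rem : R -> R -> R -> R -> R -> R)
    (lamell : R -> R -> R -> R -> R -> R) :
  turing_instability S kc ->
  lambda_M S kc != 0 ->
  kernel_vectors S kc E0 E0s ->
  rho_nl S kc E0 E0s < 0 ->
  velocity_expansion S kc c ->
  stripe_existence S kc E0 E0s c amp rem ->
  lambda_ell_expansion S kc E0 E0s lamell ->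
  (forall b0 : R, 0 < b0 ->
   exists C eps0 : R, 0 < eps0 /\
   forall (eps a b kap l A : R) (u : field R), 0 < eps < eps0 ->
   `|a| <= b0 -> `|b| <= b0 -> `|kap| <= b0 -> `|l| <= b0 ->
   scaled_stripe S kc c eps a b kap u -> small b0 eps u ->
   amp (eps ^+ 2 * a) (eps * b) (eps * kap) u = eps * A ->
   exists lam : R,
     (forall z : R[i],
        double_eigenvalue (L2sq S kc E0 E0s lamell eps a b kap l A) z
        <-> z = lam%:C) /\
     `|lam - eps ^+ 2 * (A ^+ 2 * (3 * k0 S E0 E0s - q2 S kc E0 E0s
                                   + 8 * q11 S kc E0 E0s)
                         - rho_beta S kc E0 E0s * b ^+ 2
                         + rho_kappa S kc E0 E0s * (l ^+ 2 - kap ^+ 2))|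
       <= C * eps ^+ 3)
  /\
  (forall b0 delta : R, 0 < b0 -> 0 < delta ->
   exists C eps0 : R, 0 < eps0 /\
   forall (eps a b kap A : R) (u : field R), 0 < eps < eps0 ->
   `|a| <= b0 -> `|b| <= b0 -> `|kap| <= b0 ->
   scaled_stripe S kc c eps a b kap u -> small b0 eps u ->
   amp (eps ^+ 2 * a) (eps * b) (eps * kap) u = eps * A ->
   let A2 := - (a + rho_beta S kc E0 E0s * b ^+ 2
                + rho_kappa S kc E0 E0s * kap ^+ 2) / rho_nl S kc E0 E0s in
   delta <= A2 ->
   `|A - Num.sqrt A2| <= C * eps).
Proof.
move=> _ _ kerE nl_lt0 _ exS lamP; split=> [b0 b0_gt0|b0 delta b0_gt0 delta_gt0].
- have [C1 [e1 [_ e1_gt0 H1]]] := stripe_amplitude_balance kerE exS _ b0_gt0.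
  have [C2 [e2 [e2_gt0 H2]]] := lamP _ b0_gt0.
  exists (C1 + C2), (Num.min e1 e2); split; first by rewrite lt_min e1_gt0.
  move=> eps a b kap l A u; rewrite lt_min => /and3P[eps_gt0 epse1 epse2].
  move=> ha hb hk hl su smu ampu.
  have [|_ balance] := H1 eps a b kap A u _ ha hb hk su smu ampu.
    by rewrite eps_gt0.
  have := H2 eps a b kap l _ ha hb hk hl; rewrite eps_gt0 => /(_ epse2) lam_le.
  exists (eps ^+ 2 * (lamell eps a b kap l + A ^+ 2 * xi S kc E0 E0s)).
  split=> [z|]; first exact: double_eigenvalue_scalar.
  rewrite -mulrBr normrM (ger0_norm (sqr_ge0 eps)) (exprD eps 2 1) [leRHS]mulrCA.
  rewrite ler_wpM2l ?sqr_ge0 // [leRHS]mulrDl.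
  (* With [eps ^+ 2] factored out, the error is exactly the sum of the two quantities bounded in
     [balance] and [lam_le]. *)
  apply: le_trans _ (lerD balance lam_le); apply: le_trans _ (ler_normD _ _).
  rewrite le_eqVlt; apply/orP; left; apply/eqP; congr (`|_|).
  by rewrite /xi /rho_nl; ring.
- have [C [e [C_ge0 e_gt0 H]]] := stripe_amplitude_balance kerE exS _ b0_gt0.
  set r := rho_nl S kc E0 E0s in nl_lt0 *.
  have sd_gt0 : 0 < Num.sqrt delta by rewrite sqrtr_gt0.
  (* The square root is not Lipschitz at 0; [delta] keeps [A + Num.sqrt A2] above [Num.sqrt delta],
     by which the balance is divided. *)
  exists (C / (- r * Num.sqrt delta)), e; split=> //.
  move=> eps a b kap A u he ha hb hk su smu ampu A2 dA2.
  have [A_gt0] := H eps a b kap A u he ha hb hk su smu ampu.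
  have A2_ge0 : 0 <= A2 by apply: le_trans dA2; exact: ltW.
  (* By the definition of [A2] the balance is [r * (A ^+ 2 - A2)], a difference of squares. *)
  have -> : a + rho_beta S kc E0 E0s * b ^+ 2 + rho_kappa S kc E0 E0s * kap ^+ 2
      + rho_nl S kc E0 E0s * A ^+ 2
    = r * ((A - Num.sqrt A2) * (A + Num.sqrt A2)).
    rewrite -subr_sqr sqr_sqrtr // /A2 -/r; field.
    by rewrite lt_eqF.
  rewrite !normrM (ltr0_norm nl_lt0) => balance.
  rewrite mulrAC ler_pdivlMr ?mulr_gt0 ?oppr_gt0 //; apply: le_trans _ balance.
  rewrite mulrCA ler_wpM2l ?oppr_ge0 ?(ltW nl_lt0) // ler_wpM2l //.
  apply: le_trans _ (ler_norm _); apply: le_trans (ler_wsqrtr dA2) _.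
  by rewrite lerDr ltW.
Qed.
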